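(* Let $\vartheta$ be a non-degenerate, constant length, primitive, compatible random substitution with disjoint images of letters which admits at least one recognisable word. Then every countable direct sum of finite groups embeds into $\operatorname{Aut}(X_\vartheta)$.
   Context: A random substitution on a finite alphabet $\mathcal A$ is a map $\vartheta$ from $\mathcal A$ to non-empty finite sets of non-empty words, extended to words by concatenating choices and iterated. Legal words are subwords of words in some $\vartheta^p(a)$; $X_\vartheta\subseteq\mathcal A^{\mathbb Z}$ is the set of sequences all of whose subwords are legal; $\operatorname{Aut}(X_\vartheta)$ is the group of shift-commuting homeomorphisms of $X_\vartheta$. $\vartheta$ is non-degenerate if $\#\vartheta(a)\ge2$ for some $a$; constant length if all words in all $\vartheta(a)$ have the same length; compatible if for each $a$ all words in $\vartheta(a)$ have the same letter counts; primitive if for some $p\ge1$ every letter occurs in a word of $\vartheta^p(b)$ for every $b$; has disjoint images of letters if $\vartheta(a)\cap\vartheta(b)\neq\varnothing$ implies $a=b$. An inflation word decomposition of a legal word $u$ is a pair $([u_1,\ldots,u_\ell],v)$ with non-empty words $u_i$, $u_1\cdots u_\ell=u$, and a legal word $v=v_1\cdots v_\ell$ ($v_i$ letters) such that $u_i\in\vartheta(v_i)$ for $2\le i\le\ell-1$, $u_1$ is a suffix of a word in $\vartheta(v_1)$, $u_\ell$ a prefix of a word in $\vartheta(v_\ell)$; it induces in the obvious way a decomposition on each subword occurrence. A legal word $u$ is recognisable if there is $N\ge0$ such that for every legal $w=u^{(l)}uu^{(r)}$ with $|u^{(l)}|=|u^{(r)}|=N$, all inflation word decompositions of $w$ induce the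 same decomposition on the central occurrence of $u$. *)

(* Defs.v *)
From mathcomp Require Import all_boot all_order all_algebra all_fingroup.
Set Implicit Arguments. Unset Strict Implicit. Unset Printing Implicit Defensive.
Import GRing.Theory Num.Theory.

(* A random substitution on a finite alphabet A is represented by
   th : A -> seq (seq A); th a is (an enumeration of) the finite set
   vartheta(a).  Well-formedness (non-empty set of non-empty words) is
   the hypothesis [rs_wf]. *)

Section RandomSubstitution.
Variable A : finType.
Variable th : A -> seq (seq A).

Definition rs_wf : Prop :=
  forall a, th a != [::] /\ all (fun w => w != [::]) (th a).

Definition img (v : seq A) : seq (seq A) :=
  foldr (fun a acc => [seq u ++ w | u <- th a, w <- acc]) [:: [::]] v.

Definition imgp (p : nat) (v : seq A) : seq (seq A) :=
  iter p (fun S => flatten [seq img w | w <- S]) [:: v].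

Definition rs_legal (u : seq A) : Prop :=
  exists (p : nat) (a : A) (w : seq A), w \in imgp p [:: a] /\ infix u w.

Definition rs_nondegenerate : Prop := exists a, 2 <= size (undup (th a)).

Definition rs_constant_length : Prop :=
  exists L : nat, forall a w, w \in th a -> size w = L.

Definition rs_compatible : Prop :=
  forall a u v, u \in th a -> v \in th a -> forall b, count_mem b u = count_mem b v.

Definition rs_primitive : Prop :=
  exists p : nat, 0 < p /\ forall a b, exists w, w \in imgp p [:: b] /\ a \in w.

Definition rs_disjoint_images : Prop :=
  forall a b w, w \in th a -> w \in th b -> a = b.

Definition is_iwd (u : seq A) (us : seq (seq A)) (v : seq A) : Prop :=
  [/\ all (fun x => x != [::]) us, flatten us = u, rs_legal v,
      size v = size us &
      forall (i : nat) (ui : seq A) (a : A),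
        onth us i = Some ui -> onth v i = Some a ->
        [/\ (0 < i < (size us).-1 -> ui \in th a),
            (i = 0 -> exists x, x \in th a /\ suffix ui x) &
            (i = (size us).-1 -> exists x, x \in th a /\ prefix ui x)]].

(* the decomposition induced by (us, v) on the occurrence of length n
   starting at position p; [pos] is the starting position of the first
   block of us *)
Fixpoint restr (us : seq (seq A)) (v : seq A) (pos p n : nat)
  : seq (seq A) * seq A :=
  match us, v with
  | u :: us', a :: v' =>
      let e := pos + size u in
      let rest := restr us' v' e p n in
      if (pos < p + n) && (p < e) then
        (take (minn e (p + n) - maxn pos p) (drop (maxn pos p - pos) u) :: rest.1,
         a :: rest.2)
      else rest
  | _, _ => ([::], [::])
  end.

Definition rs_recognisable (u : seq A) : Prop :=
  rs_legal u /\
  exists N : nat, forall ul ur : seq A, size ul = N -> size ur = N ->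
    rs_legal (ul ++ u ++ ur) ->
    forall us1 v1 us2 v2,
      is_iwd (ul ++ u ++ ur) us1 v1 -> is_iwd (ul ++ u ++ ur) us2 v2 ->
      restr us1 v1 0 N (size u) = restr us2 v2 0 N (size u).

Definition in_X (x : int -> A) : Prop :=
  forall (i : int) (n : nat), rs_legal [seq x (i + k%:Z)%R | k <- iota 0 n].

Definition shift (x : int -> A) : int -> A := fun k => x (k + 1)%R.

Definition agree (x y : int -> A) (m : nat) : Prop :=
  forall k : int, (`|k| <= m)%N -> x k = y k.

Definition maps_X (f : (int -> A) -> (int -> A)) : Prop :=
  forall x, in_X x -> in_X (f x).

(* continuity on X for the (relative) product topology of discrete spaces *)
Definition cont_X (f : (int -> A) -> (int -> A)) : Prop :=
  forall x, in_X x -> forall n : nat, exists m : nat,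
    forall y, in_X y -> agree x y m -> agree (f x) (f y) n.

Definition is_aut (f : (int -> A) -> (int -> A)) : Prop :=
  [/\ maps_X f, cont_X f,
      (forall x, in_X x -> f (shift x) = shift (f x)) &
      exists g, [/\ maps_X g, cont_X g,
                    (forall x, in_X x -> g (f x) = x) &
                    (forall x, in_X x -> f (g x) = x)]].

End RandomSubstitution.

Definition finsupp (I : countType) (G : I -> finGroupType)
  (g : forall i, G i) : Prop :=
  exists s : seq I, forall i, i \notin s -> g i = 1%g.

(* Main.v *)
(* To a word w attach the set of residues mod L at which w can be cut into inflation words;
   this set can only shrink when w is extended, so some w (called stable) keeps
   its set in all legal extensions. Once a decomposition aligned with a given
   inflation word occurs next to w in one legal word, it is therefore available
   in every legal word containing w, and since the images of letters are disjoint
   that inflation word may be replaced by another image of the same letter.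
   Legal words are exponentially many, so some legal word w0 is avoided by
   arbitrarily long products of level-(m+1) blocks even if each block is chosen
   freely between two variants. For a stable w containing w0, take the stretch
   from the last w before to the first w after such a product: it gives words
   w s_j w with w occurring only at both ends, and with the s_j interchangeable.
   Assigning to each group G_i such a family s_i of |G_i| words of length n_i, the
   n_i being distinct, an element g acts by replacing s_i(h) by s_i(g_i h)
   between consecutive occurrences of w, and the occurrences of w never change. *)
Require Import Defs.
From mathcomp Require Import all_boot all_order all_algebra all_fingroup zify.
From Stdlib Require Import Classical ClassicalEpsilon FunctionalExtensionality.
Set Implicit Arguments. Unset Strict Implicit. Unset Printing Implicit Defensive.

(** * Occurrences in words *)

Section Words.
Variable T : eqType.
Implicit Types (u v w x y z : seq T).

Lemma cat_overlap u v x y : size u <= size x -> u ++ v = x ++ y ->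
  exists t, x = u ++ t /\ v = t ++ y.
Proof.
move=> ux E; exists (drop (size u) x).
have Ex : take (size u) x = u by rewrite -(takel_cat y ux) -E take_size_cat.
have {1}-> : x = u ++ drop (size u) x by rewrite -{1}Ex cat_take_drop.
split=> //; have := congr1 (drop (size u)) E.
by rewrite drop_size_cat // drop_cat ltn_neqAle ux andbT; case: eqP => // ->; rewrite subnn drop0 drop_size.
Qed.

Lemma cat_mid w p z q x y : p ++ z ++ q = x ++ w ++ y ->
  size p <= size x -> size x + size w <= size p + size z ->
  exists x' y', [/\ x = p ++ x', z = x' ++ w ++ y' & y = y' ++ q].
Proof.
move=> E px xz; have [x' [Ex E']] := cat_overlap px E.
rewrite catA in E'; have [|y' [Ez Ey]] := cat_overlap _ (esym E').
  by move: xz; rewrite Ex !size_cat; lia.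
by exists x', y'; rewrite catA.
Qed.

(** A factor as long as one block meets at most two neighbouring blocks. Adjacency is not recorded,
    since the factor will be excluded from all pairs of blocks. *)
Lemma infix_flatten n (bs : seq (seq T)) w : 0 < n -> size w = n ->
  (forall b, b \in bs -> size b = n) -> infix w (flatten bs) ->
  exists b b', [/\ b \in bs, b' \in bs & infix w (b ++ b')].
Proof.
move=> n0 Ew; elim: bs => [|b bs IH] Hs.
  by rewrite infixs0 => /eqP w0; move: n0; rewrite -Ew w0.
move=> /infixP [x [y /= E]]; have Eb := Hs b (mem_head _ _).
have [nx|xn] := leqP n (size x).
  have [|t [Ex E']] := cat_overlap _ E; first by rewrite Eb.
  have [c H||c [c' [H1 H2 H3]]] := IH.
  - by apply: Hs; rewrite inE H orbT.
  - by rewrite E' infix_infix.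
  by exists c, c'; rewrite !inE H1 H2 !orbT.
case: bs E Hs {IH} => [|c bs] /= E Hs.
  by exists b, b; rewrite mem_head -{1}(cats0 b) E; split=> //; apply: infix_catr; exact: infix_infix.
have Ec : size c = n by apply: Hs; rewrite !inE eqxx orbT.
exists b, c; rewrite mem_head !inE eqxx orbT; split=> //.
have [|||x' [y' [_ -> _]]] := @cat_mid w [::] (b ++ c) (flatten bs) x y.
- by rewrite /= -catA.
- by [].
- by rewrite /= size_cat Ew Eb Ec; lia.
exact: infix_infix.
Qed.

(** Each later occurrence of [w] leaves a shorter tail, so passing to a later one terminates. *)
Lemma last_occurrence w l : exists l0 l', w ++ l = l0 ++ w ++ l' /\
  forall x y, w ++ l' = x ++ w ++ y -> x = [::].
Proof.
have [n le_n] := ubnP (size l); elim: n l le_n => // n IH l le_n.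
case: (classic (forall x y, w ++ l = x ++ w ++ y -> x = [::])) => [H|H].
  by exists [::], l.
have [x [y [E xn]]] : exists x y, w ++ l = x ++ w ++ y /\ x <> [::].
  apply: NNPP => N; apply: H => x y E; apply: NNPP => xn.
  by apply: N; exists x, y.
have [|l0 [l' [E' H']]] := IH y.
  have := congr1 size E; rewrite !size_cat.
  by case: x xn {E} => //= a x _; lia.
by exists (x ++ l0), l'; rewrite E E' catA.
Qed.

Lemma first_occurrence w r : exists r' r0, r ++ w = r' ++ w ++ r0 /\
  forall x y, r' ++ w = x ++ w ++ y -> y = [::].
Proof.
have [l0 [l' [E H]]] := last_occurrence (rev w) (rev r).
exists (rev l'), (rev l0); split.
  by apply: (can_inj revK); rewrite !rev_cat !revK E catA.
move=> x y /(congr1 rev); rewrite !rev_cat revK -catA => /(H (rev y) (rev x)).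
by move/(congr1 rev); rewrite revK.
Qed.

(* An occurrence of [w] inside [w l' m r' w] that meets [m] would lie in [zl m zr]. *)
Lemma return_word w l zl m zr r l0 l' r' r0 :
  size w <= size zl -> size w <= size zr -> ~~ infix w (zl ++ m ++ zr) ->
  w ++ l ++ zl = l0 ++ w ++ l' -> (forall x y, w ++ l' = x ++ w ++ y -> x = [::]) ->
  zr ++ r ++ w = r' ++ w ++ r0 -> (forall x y, r' ++ w = x ++ w ++ y -> y = [::]) ->
  forall x y, w ++ (l' ++ m ++ r') ++ w = x ++ w ++ y -> x = [::] \/ y = [::].
Proof.
move=> wzl wzr N El Hl Er Hr x y E.
have Sl := congr1 size El; have Sr := congr1 size Er; rewrite !size_cat in Sl Sr.
have [c1|c1] := leqP (size x + size w) (size w + size l').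
  left; have [|||x' [y' [Ex /Hl E' _]]] := @cat_mid w [::] (w ++ l') (m ++ r' ++ w) x y.
  - by rewrite -E /= -!catA.
  - by [].
  - by rewrite size_cat.
  by rewrite Ex E'.
have [c2|c2] := leqP (size w + size l' + size m) (size x).
  right; have [|||x' [y' [_ /Hr E' Ey]]] := @cat_mid w (w ++ l' ++ m) (r' ++ w) [::] x y.
  - by rewrite -E cats0 -!catA.
  - by rewrite !size_cat addnA.
  - by have := congr1 size E; rewrite !size_cat; lia.
  by rewrite Ey E'.
case/negP: N.
have [|||x' [y' [_ -> _]]] := @cat_mid w (w ++ l) (zl ++ m ++ zr) (r ++ w) (l0 ++ x) (y ++ r0).
- have -> : (w ++ l) ++ (zl ++ m ++ zr) ++ r ++ w = (w ++ l ++ zl) ++ m ++ (zr ++ r ++ w).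
    by rewrite -!catA.
  have -> : (l0 ++ x) ++ w ++ y ++ r0 = l0 ++ (x ++ w ++ y) ++ r0 by rewrite -!catA.
  by rewrite El Er -E -!catA.
- by rewrite !size_cat; lia.
- by rewrite !size_cat; lia.
exact: infix_infix.
Qed.

End Words.

(** With [Y] half of [X], [2 ^ X] is at least [Y.+1 * Y.+1]: one factor beats [2 * C], the other is
    at least half of [X.+1]. *)
Lemma exp_gt_linear C : exists X0, forall X, X0 <= X -> C * X.+1 < 2 ^ X.
Proof.
exists (4 * C + 4) => X HX; pose Y := X./2.
have [EX HY] : X = odd X + Y + Y /\ 2 * C < Y.+1.
  by have := odd_double_half X; rewrite -/Y -addnn; case: (odd X) => /=; lia.
have H1 : Y.+1 * Y.+1 <= 2 ^ X.
  apply: (@leq_trans (2 ^ Y * 2 ^ Y)); first by apply: leq_mul; exact: ltn_expl.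
  by rewrite -expnD leq_exp2l // EX -addnA leq_addl.
apply: leq_trans H1; have : X.+1 <= 2 * Y.+1 by case: (odd X) EX => /=; lia.
by move=> H2; nia.
Qed.
(** * Legal words *)

Section Language.
Variables (A : finType) (th : A -> seq (seq A)).

Lemma img_cat v1 v2 w :
  reflect (exists w1 w2, [/\ w = w1 ++ w2, w1 \in img th v1 & w2 \in img th v2])
          (w \in img th (v1 ++ v2)).
Proof.
elim: v1 w => [|a v1 IH] w /=.
  apply: (iffP idP) => [H|[w1 [w2 []]]]; first by exists [::], w; split.
  by rewrite inE => -> /eqP ->.
apply: (iffP allpairsP) => [[[u t] /= [Hu /IH [w1 [w2 [-> H1 H2]]] ->]]|].
  exists (u ++ w1), w2; rewrite catA; split=> //.
  by apply/allpairsP; exists (u, w1).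
case=> w1 [w2 [-> /allpairsP [[u t] /= [Hu Ht ->]] H2]].
exists (u, t ++ w2); rewrite /= catA; split=> //.
by apply/IH; exists t, w2.
Qed.

Lemma mem_img_cat v1 v2 w1 w2 :
  w1 \in img th v1 -> w2 \in img th v2 -> w1 ++ w2 \in img th (v1 ++ v2).
Proof. by move=> H1 H2; apply/img_cat; exists w1, w2. Qed.

Lemma img1 a : img th [:: a] = th a.
Proof. by rewrite /= ; elim: (th a) => //= u s ->; rewrite cats0. Qed.

Lemma mem_img_cons a v u w : u \in th a -> w \in img th v -> u ++ w \in img th (a :: v).
Proof. by move=> Hu Hw; apply/allpairsP; exists (u, w). Qed.

Lemma imgpSP p v w :
  reflect (exists2 z, z \in imgp th p v & w \in img th z) (w \in imgp th p.+1 v).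
Proof. by apply: (iffP flatten_mapP). Qed.

Lemma mem_imgp_cat p v1 v2 w1 w2 :
  w1 \in imgp th p v1 -> w2 \in imgp th p v2 -> w1 ++ w2 \in imgp th p (v1 ++ v2).
Proof.
elim: p w1 w2 => [|p IH] w1 w2; first by rewrite !inE => /eqP -> /eqP ->.
move=> /imgpSP [z1 H1 G1] /imgpSP [z2 H2 G2]; apply/imgpSP; exists (z1 ++ z2).
  exact: IH.
exact: mem_img_cat.
Qed.

Lemma imgp_addP q p v w :
  reflect (exists2 z, z \in imgp th p v & w \in imgp th q z) (w \in imgp th (q + p) v).
Proof.
elim: q w => [|q IH] w.
  by apply: (iffP idP) => [H|[z Hz]]; [exists w => //; rewrite inE | rewrite inE => /eqP ->].
rewrite addSn; apply: (iffP (imgpSP _ _ _)) => [[z /IH [y Hy Hz] Hw]|[y Hy /imgpSP [z Hz Hw]]].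
  by exists y => //; apply/imgpSP; exists z.
by exists z => //; apply/IH; exists y.
Qed.

Hypothesis wf : rs_wf th.

Lemma th_inhabited a : exists u, u \in th a.
Proof. by have [] := wf a; case: (th a) => // u s _ _; exists u; rewrite mem_head. Qed.

Lemma img_inhabited v : exists w, w \in img th v.
Proof.
elim: v => [|a v [w Hw]]; first by exists [::].
by have [u Hu] := th_inhabited a; exists (u ++ w); exact: mem_img_cons.
Qed.

Lemma imgp_inhabited p v : exists w, w \in imgp th p v.
Proof.
elim: p => [|p [z Hz]]; first by exists v; rewrite inE.
by have [w Hw] := img_inhabited z; exists w; apply/imgpSP; exists z.
Qed.

Lemma legal_infix u w : infix u w -> rs_legal th w -> rs_legal th u.
Proof. by move=> H [p [a [z [Hz Hw]]]]; exists p, a, z; split=> //; exact: infix_trans Hw. Qed.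

Lemma legal_imgp q v w : rs_legal th v -> w \in imgp th q v -> rs_legal th w.
Proof.
move=> [p [a [z [Hz /infixP [x [y E]]]]]] Hw.
have [x' Hx] := imgp_inhabited q x; have [y' Hy] := imgp_inhabited q y.
exists (q + p), a, (x' ++ w ++ y'); split; last exact: infix_infix.
by apply/imgp_addP; exists z => //; rewrite E; do 2!apply: mem_imgp_cat => //.
Qed.

Lemma legal_img v w : rs_legal th v -> w \in img th v -> rs_legal th w.
Proof.
by move=> Hv Hw; apply: (@legal_imgp 1 v) => //; apply/imgpSP; exists v => //; rewrite inE.
Qed.

Lemma legal_letter a : rs_legal th [:: a].
Proof. by exists 0, a, [:: a]; split; rewrite ?inE ?infix_refl. Qed.

Variable L : nat.
Hypothesis thL : forall a w, w \in th a -> size w = L.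

Lemma size_img v w : w \in img th v -> size w = L * size v.
Proof.
elim: v w => [|a v IH] w; first by rewrite inE => /eqP ->; rewrite muln0.
by move/allpairsP => [[u t] /= [Hu Ht ->]]; rewrite size_cat (IH _ Ht) (thL Hu) mulnS.
Qed.

Lemma size_imgp p v w : w \in imgp th p v -> size w = L ^ p * size v.
Proof.
elim: p w => [|p IH] w; first by rewrite inE => /eqP ->; rewrite mul1n.
by move/imgpSP => [z Hz /size_img ->]; rewrite (IH _ Hz) expnS mulnA.
Qed.

(** All inflation words have length [L], so a prefix of length divisible by [L] ends on a boundary
    between them. *)
Lemma img_split v w1 w2 : L %| size w1 -> w1 ++ w2 \in img th v ->
  exists v1 v2, [/\ v = v1 ++ v2, w1 \in img th v1 & w2 \in img th v2].
Proof.
move=> /dvdnP [k Ek] H.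
have [L0|L0] := posnP L.
  have w10 : w1 = [::] by apply/nilP; rewrite /nilp Ek L0 muln0.
  by exists [::], v; split=> //; rewrite w10 in H *.
exists (take k v), (drop k v); rewrite cat_take_drop.
have kv : k <= size v.
  by rewrite -(leq_pmul2l L0) -(size_img H) size_cat Ek mulnC leq_addr.
move: (H); rewrite -{1}(cat_take_drop k v) => /img_cat [t1 [t2 [E H1 H2]]].
have := size_img H1; rewrite size_takel // mulnC -Ek => S1.
by move/eqP: E; rewrite eqseq_cat ?S1 // => /andP [/eqP -> /eqP ->].
Qed.

Hypothesis disj : rs_disjoint_images th.

(** Equal lengths align the two factorisations, and disjointness of images lets each block determine
    its letter. *)
Lemma img_inj v v' w : 0 < L -> w \in img th v -> w \in img th v' -> v = v'.
Proof.
move=> L0; elim: v v' w => [|a v IH] v' w H H'.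
  have := size_img H; rewrite (size_img H') muln0 => /eqP.
  by rewrite muln_eq0 gtn_eqF //= => /nilP.
case: v' H' => [|b v'] H'.
  by have := size_img H; rewrite (size_img H') muln0 => /eqP; rewrite eq_sym muln_eq0 gtn_eqF.
move: H H' => /allpairsP [[u t] /= [Hu Ht ->]] /allpairsP [[u' t'] /= [Hu' Ht']].
move/eqP; rewrite eqseq_cat ?(thL Hu) ?(thL Hu') // => /andP [/eqP E1 /eqP E2].
by rewrite -E1 in Hu'; rewrite -E2 in Ht'; rewrite (disj Hu Hu') (IH _ _ Ht Ht').
Qed.

Hypothesis prim : rs_primitive th.

(** Past the exponent [p] of primitivity, take any word at level [q - p]: its first letter already
    yields every letter [p] levels later. *)
Lemma primitive_large : exists q0, forall q, q0 <= q ->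
  forall a b, exists2 w, w \in imgp th q [:: b] & a \in w.
Proof.
have [p [_ H]] := prim; exists p => q pq a b.
have [z Hz] := imgp_inhabited (q - p) [:: b].
have [|z0] := eqVneq z [::] => [Ez|].
  have := size_imgp Hz; rewrite Ez muln1 /= => /eqP; rewrite eq_sym expn_eq0 => /andP [/eqP L0 _].
  have [w [/size_imgp]] := H a b; have [p0 Hp] := prim.
  have [u /[dup] /thL] := th_inhabited a.
  rewrite L0 => /size0nil -> Hu; have [_ /allP /(_ _ Hu)] := wf a.
  by rewrite eqxx.
case: z z0 Hz => // c z _ Hz; have [w [Hw aw]] := H a c.
have [t Ht] := imgp_inhabited p z.
exists (w ++ t); last by rewrite mem_cat aw.
rewrite -(subnKC pq); apply/imgp_addP; exists (c :: z) => //.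
by rewrite -cat1s; apply: mem_imgp_cat.
Qed.

Lemma legal_deep u : rs_legal th u -> exists Q, forall q, Q <= q ->
  forall b, exists2 w, w \in imgp th q [:: b] & infix u w.
Proof.
move=> [p [a [z [Hz uz]]]]; have [q0 H] := primitive_large.
exists (p + q0) => q Hq b.
have [|w Hw aw] := H (q - p) _ a b; first by lia.
case/path.splitPr: aw Hw => x y Hw.
have [x' Hx] := imgp_inhabited p x; have [y' Hy] := imgp_inhabited p y.
exists (x' ++ z ++ y'); last by apply: infix_catl; exact: infix_catr.
have -> : q = p + (q - p) by lia.
apply/imgp_addP; exists (x ++ a :: y) => //.
by rewrite -cat1s; do 2!apply: mem_imgp_cat => //.
Qed.

Hypothesis L2 : 1 < L.

(** As [1 < L], some legal word starts with two letters [b], [c]; at a common deep level [u] occurs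
    in an image of [b] and [v] in one of [c]. *)
Lemma legal_join u v : rs_legal th u -> rs_legal th v ->
  exists t, rs_legal th (u ++ t ++ v).
Proof.
move=> Hu Hv; have [p [a _]] := Hu.
have [[|b [|c z]] Hz] := th_inhabited a.
- by have := thL Hz => /= L0; move: L2; rewrite -L0.
- by have := thL Hz => /= L0; move: L2; rewrite -L0.
have [Q1 H1] := legal_deep Hu; have [Q2 H2] := legal_deep Hv.
pose q := Q1 + Q2.
have [|w1 Hw1 /infixP [x1 [y1 E1]]] := H1 q _ b; first by rewrite leq_addr.
have [|w2 Hw2 /infixP [x2 [y2 E2]]] := H2 q _ c; first by rewrite leq_addl.
have [t Ht] := imgp_inhabited q z.
exists (y1 ++ x2); apply: (@legal_infix _ (w1 ++ w2 ++ t)).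
  by apply/infixP; exists x1, (y2 ++ t); rewrite E1 E2 !catA.
apply: (@legal_imgp q ([:: b] ++ [:: c] ++ z)); last by do 2!apply: mem_imgp_cat => //.
by apply: (@legal_img [:: a]); [exact: legal_letter | rewrite img1].
Qed.

Lemma legal_desubstitute m w : rs_legal th w ->
  exists v u, [/\ rs_legal th v, u \in imgp th m v & infix w u].
Proof.
move=> Hw; have [p [a _]] := Hw.
have [Q /(_ (m + Q) (leq_addl _ _) a) [u /imgp_addP [v Hv Hu] wu]] := legal_deep Hw.
by exists v, u; split=> //; exact: legal_imgp (legal_letter a) Hv.
Qed.

Lemma legal_extend u : rs_legal th u -> exists a b, rs_legal th (a :: rcons u b).
Proof.
move=> Hu; have [_ [a _]] := Hu.
have [t H1] := legal_join (legal_letter a) Hu.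
have [t' H2] := legal_join H1 (legal_letter a).
have E1 : [:: a] ++ t = rcons (belast a t) (last a t) by rewrite -lastI.
have [b [y E2]] : exists b y, t' ++ [:: a] = b :: y.
  by case: t' H2 => [|b y] _; [exists a, [::] | exists b, (y ++ [:: a])].
exists (last a t), b; apply: legal_infix H2.
apply/infixP; exists (belast a t), y.
by rewrite E2 [[:: a] ++ _]catA E1 -!cats1 -!catA /= -!catA.
Qed.

Lemma legal_size (a0 : A) n : exists v, rs_legal th v /\ size v = n.
Proof.
have [z Hz] := imgp_inhabited n [:: a0].
exists (take n z); split.
  apply: legal_infix (legal_imgp (legal_letter a0) Hz).
  by rewrite -{2}(cat_take_drop n z); exact: prefix_infix.
by rewrite size_takel // (size_imgp Hz) muln1 ltnW // ltn_expl.
Qed.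


(** * Stable words *)

(** The number [c] is a phase: an offset modulo [L] at which [z] can sit in a product of inflation
    words. *)
Definition cut_at (z : seq A) (c : nat) : Prop := exists v pre post,
  [/\ rs_legal th v, pre ++ z ++ post \in img th v & size pre = c %[mod L]].

Definition stable (w : seq A) : Prop := forall x y c,
  rs_legal th (x ++ w ++ y) -> cut_at w (c + size x) -> cut_at (x ++ w ++ y) c.

Lemma cut_at_mod z c d : c = d %[mod L] -> cut_at z c -> cut_at z d.
Proof. by move=> E [v [p [q [H1 H2 H3]]]]; exists v, p, q; rewrite -E. Qed.

Lemma cut_at_sub x w y c : cut_at (x ++ w ++ y) c -> cut_at w (c + size x).
Proof.
move=> [v [p [q [H1 H2 H3]]]]; exists v, (p ++ x), (y ++ q).
split=> //; first by move: H2; rewrite -!catA.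
by rewrite size_cat -modnDml H3 modnDml.
Qed.

Lemma stable_cat x w y : stable w -> stable (x ++ w ++ y).
Proof.
move=> Sw x' y' c; rewrite -!catA !(catA x') => Hl /cut_at_sub.
by rewrite -addnA -size_cat; exact: Sw.
Qed.

(** The list [s] bounds the phases of [w] up to a shift [a], which absorbs left extensions. An
    unstable [w] has an extension that loses a phase, so [s] can be shortened. *)
Lemma stable_exists w : rs_legal th w -> exists w', rs_legal th w' /\ stable w'.
Proof.
suff H n : forall s a w, size s = n -> rs_legal th w ->
    (forall c, cut_at w c -> (c + a) %% L \in s) ->
    exists w', rs_legal th w' /\ stable w'.
  move=> Hw; apply: (H _ (iota 0 L) 0 w erefl Hw) => c _.
  by rewrite mem_iota /= add0n ltn_mod (ltnW L2).
elim: n => [|n IH] s a {}w Es Hw Hs.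
  exists w; split=> // x y c _ /Hs.
  by move/size0nil: Es => ->.
apply: NNPP => NE; apply: (NE); exists w; split=> // x y c Hl Hc; apply: NNPP => Nc.
apply: NE; have cs := Hs _ Hc.
apply: (IH (seq.rem ((c + size x + a) %% L) s) (size x + a) (x ++ w ++ y)) => //.
  by rewrite size_rem // Es.
move=> c' Hc'; have := Hs _ (cut_at_sub Hc'); rewrite addnA.
have [E _|NE] := eqVneq ((c' + size x + a) %% L) ((c + size x + a) %% L).
  case: Nc; apply: cut_at_mod Hc'.
  by move/eqP: E; rewrite !eqn_modDr => /eqP.
by rewrite (perm_mem (perm_to_rem cs)) inE (negPf NE).
Qed.

(* Stability makes the decomposition in which [M] is a union of inflation words
   available in every legal word containing [w ++ l ++ M], even if the cutting
   points are not determined by [w]. *)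
Lemma stable_swap w y1 V pre l M M' x y :
  stable w -> rs_legal th y1 -> pre ++ w ++ l \in img th y1 ->
  M \in img th V -> M' \in img th V ->
  rs_legal th (x ++ w ++ l ++ M ++ y) -> rs_legal th (x ++ w ++ l ++ M' ++ y).
Proof.
move=> Sw H1 Hpre HM HM' Hl.
(* Adding [size x * L.-1] subtracts [size x] modulo [L], so that [w] gets the phase of [pre]. *)
have Cw : cut_at w (size pre + size x * L.-1 + size x).
  exists y1, pre, l; split=> //.
  by rewrite -addnA -mulnSr prednK ?(ltnW L2) // addnC modnMDl.
have [v [p [q [Hv]]]] := Sw x (l ++ M ++ y) _ Hl Cw.
rewrite -!catA => Him Ep.
have D1 : L %| size (p ++ x ++ w ++ l).
  rewrite size_cat /dvdn -modnDml Ep modnDml !size_cat.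
  have := size_img Hpre; rewrite !size_cat => E.
  have -> : size pre + size x * L.-1 + (size x + (size w + size l)) =
            L * size y1 + size x * L.
    have F : size x * L.-1 + size x = size x * L by rewrite -mulnSr prednK ?(ltnW L2).
    by rewrite -E -F [RHS]addnACA [_ + size x]addnC.
  by rewrite addnC modnMDl modnMr.
have Ec : p ++ x ++ w ++ l ++ M ++ y ++ q = (p ++ x ++ w ++ l) ++ M ++ y ++ q.
  by rewrite -!catA.
move: Him; rewrite Ec => /(img_split D1) [v1 [v2 [Ev Hv1]]].
have D2 : L %| size M by rewrite (size_img HM) dvdn_mulr.
move=> /(img_split D2) [v3 [v4 [Ev2 Hv3 Hv4]]].
(* The letters above [M] are forced to be [V], so [M'] is another image of the same word. *)
have E3 := img_inj (ltnW L2) Hv3 HM; rewrite {}E3 in Hv3 Ev2.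
have Him' := mem_img_cat Hv1 (mem_img_cat HM' Hv4).
rewrite -Ev2 -Ev in Him'.
apply: legal_infix (legal_img Hv Him').
by apply/infixP; exists p, q; rewrite -!catA.
Qed.


(** * Counting images, and blocks that avoid a legal word *)

Lemma img_many a u1 u2 v : u1 \in th a -> u2 \in th a -> u1 != u2 ->
  exists s : seq (seq A),
    [/\ uniq s, {subset s <= img th v} & size s = 2 ^ count_mem a v].
Proof.
move=> H1 H2 ne; elim: v => [|c v [s [Us Ss Zs]]]; first by exists [:: [::]]; split=> // x.
have catI x : injective (cat x : seq A -> seq A).
  by move=> y z /(congr1 (drop (size x))); rewrite !drop_size_cat.
have [x Hx] := th_inhabited c.
have sub y : y \in th c -> {subset [seq y ++ t | t <- s] <= img th (c :: v)}.
  by move=> Hy _ /mapP [t /Ss Ht ->]; exact: mem_img_cons.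
have [<-|ca] := eqVneq a c; last first.
  exists [seq x ++ t | t <- s]; split; last by rewrite size_map Zs /= eq_sym (negPf ca).
    by rewrite map_inj_uniq.
  exact: sub.
(* The lengths of [u1] and [u2] agree, so the two halves of this list are disjoint. *)
exists ([seq u1 ++ t | t <- s] ++ [seq u2 ++ t | t <- s]); split.
- rewrite cat_uniq !map_inj_uniq ?Us //= andbT.
  apply/hasPn => _ /mapP [t Ht ->]; apply/mapP => -[t' Ht' /eqP].
  by rewrite eqseq_cat ?(thL H1) ?(thL H2) // eq_sym (negPf ne).
- by move=> y; rewrite mem_cat => /orP [/mapP [t /Ss Ht ->]|/mapP [t /Ss Ht ->]]; exact: mem_img_cons.
- by rewrite size_cat !size_map Zs /= eqxx expnS mul2n addnn.
Qed.

Lemma imgp_count b q : (forall c, exists2 w, w \in imgp th q [:: c] & b \in w) ->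
  forall z, exists2 v, v \in imgp th q z & size z <= count_mem b v.
Proof.
move=> H; elim=> [|c z [v Hv Cv]]; first by have [v Hv] := imgp_inhabited q [::]; exists v.
have [w Hw bw] := H c; exists (w ++ v); first by rewrite -cat1s; exact: mem_imgp_cat.
by rewrite count_cat /= -add1n leq_add // -has_count has_pred1.
Qed.

(* There are more than [2 ^ (L ^ r)] legal words of length [L ^ m.+1], with
   [m - r] bounded, but only a multiple of [L ^ m] subwords of this length in
   the products of two blocks. *)
Lemma twin_blocks : rs_nondegenerate th -> exists m V B w,
  [/\ forall c, V c \in imgp th m [:: c],
      forall e c, B e c \in img th (V c),
      forall c, B true c <> B false c,
      rs_legal th w /\ size w = L ^ m.+1 &
      forall (e e' : bool) c c', ~~ infix w (B e c ++ B e' c')].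
Proof.
move=> [b size_b].
have [u1 [u2 [H1 H2 ne]]] : exists u1 u2, [/\ u1 \in th b, u2 \in th b & u1 != u2].
  move: size_b; have := undup_uniq (th b); have := mem_undup (th b).
  case: (undup (th b)) => [|x [|y s]] //= Hm /andP [Hx _] _.
  exists x, y; rewrite -!Hm !inE !eqxx orbT; split=> //.
  by apply: contraNneq Hx => ->; rewrite mem_head.
have [q0 Hq0] := primitive_large.
(* Number of pairs of blocks, a block being given by a variant and a letter. *)
pose C := (2 * #|A|) ^ 2.
have [X0 HX0] := exp_gt_linear (C * L ^ q0.+1).
(* The [q0] extra levels make [b] occur in every block preimage and cost only a constant factor in
   [n], which stays linear in [L ^ r]. *)
pose r := X0; pose m := q0 + r; pose n := L ^ m.+1.
have big : C * n.+1 < 2 ^ (L ^ r).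
  apply: leq_ltn_trans (HX0 _ (ltnW (ltn_expl r L2))).
  rewrite -mulnA leq_mul2l; apply/orP; right.
  rewrite /n /m -addSn expnD mulnS addnC -addn1 leq_add2l expn_gt0.
  by rewrite (ltnW L2).
have blocks c : exists VB : seq A * (seq A * seq A),
    [/\ VB.1 \in imgp th m [:: c], VB.2.1 \in img th VB.1,
        VB.2.2 \in img th VB.1 & VB.2.1 <> VB.2.2].
  have [|v Hv bv] := Hq0 m _ b c; first by rewrite leq_addr.
  case/path.splitPr: bv Hv => x y Hv.
  have [x' Hx] := img_inhabited x; have [y' Hy] := img_inhabited y.
  exists (x ++ b :: y, (x' ++ u1 ++ y', x' ++ u2 ++ y')); split=> //=.
  - by apply: mem_img_cat => //; exact: mem_img_cons.
  - by apply: mem_img_cat => //; exact: mem_img_cons.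
  move/eqP; rewrite eqseq_cat // eqxx /= eqseq_cat ?(thL H1) ?(thL H2) //.
  by rewrite (negPf ne).
have [VB HVB] := fin_all_exists blocks.
pose V c := (VB c).1; pose B (e : bool) c := if e then (VB c).2.1 else (VB c).2.2.
have HB e c : B e c \in img th (V c) by have [_ ? ? _] := HVB c; case: e.
have SB e c : size (B e c) = n.
  have [HV _ _ _] := HVB c.
  by rewrite (size_img (HB e c)) (size_imgp HV) muln1 -expnS.
(* The values of [F] include all subwords of length [n] of products of two blocks. *)
pose F (t : 'I_n.+1 * ((bool * A) * (bool * A))) :=
  take n (drop t.1 (B t.2.1.1 t.2.1.2 ++ B t.2.2.1 t.2.2.2)).
(* Each of the [L ^ r] letters of [z] yields a [b] within [q0] levels, so [v] has at least
   [2 ^ (L ^ r)] images. *)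
have [z Hz] := imgp_inhabited r [:: b].
have [v Hv Cv] := imgp_count (Hq0 q0 (leqnn _) b) z.
have [s [Us Ss Zs]] := img_many v H1 H2 ne.
have [w ws wF] : exists2 w, w \in s & w \notin codom F.
  apply/hasP; rewrite -[has _ _]negbK -all_predC; apply/negP => /allP N.
  have : size s <= size (codom F).
    by apply: uniq_leq_size => // w /N /=; rewrite negbK.
  rewrite size_codom !card_prod card_bool card_ord Zs leqNgt => /negP; apply.
  rewrite mulnC mulnn; apply: leq_trans big _.
  rewrite leq_exp2l //; apply: leq_trans Cv.
  by rewrite (size_imgp Hz) muln1.
have Hvm : v \in imgp th m [:: b] by apply/imgp_addP; exists z.
have Sw : size w = n by rewrite (size_img (Ss _ ws)) (size_imgp Hvm) muln1 -expnS.
exists m, V, B, w; split=> //.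
- by move=> c; have [] := HVB c.
- by move=> c; have [] := HVB c.
- by split=> //; apply: legal_img (Ss _ ws); apply: legal_imgp Hvm; exact: legal_letter.
move=> e e' c c'; apply: contraNN wF => /infixP [x [y E]].
have Sx : size x < n.+1 by have := congr1 size E; rewrite !size_cat !SB Sw; lia.
apply/codomP; exists (Ordinal Sx, ((e, c), (e', c'))).
by rewrite /F /= E drop_size_cat // take_size_cat.
Qed.


(** * Interchangeable words between consecutive occurrences of a marker *)

(** Indices range over all naturals, but only those below [k] must give distinct words. The third
    clause keeps markers in place under exchanges; the last keeps legality. *)
Definition switch_family (w : seq A) (k N : nat) (s : nat -> seq A) : Prop :=
  [/\ forall j, size (s j) = N,
      forall i j, i < k -> j < k -> s i = s j -> i = j,
      forall j x y, w ++ s j ++ w = x ++ w ++ y -> x = [::] \/ y = [::],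
      forall j, rs_legal th (w ++ s j ++ w) &
      forall j j' x y, rs_legal th (x ++ w ++ s j ++ w ++ y) ->
                       rs_legal th (x ++ w ++ s j' ++ w ++ y)].

Lemma flatten_imgp (X : Type) m (V : A -> seq A) (f : X -> A) s :
  (forall c, V c \in imgp th m [:: c]) ->
  flatten [seq V (f i) | i <- s] \in imgp th m [seq f i | i <- s].
Proof.
move=> HV; elim: s => [|i s IH] /=; last by rewrite -[f i :: _]cat1s; exact: mem_imgp_cat.
by elim: m {HV} => [|m IH]; rewrite ?inE //; apply/imgpSP; exists [::].
Qed.

Lemma flatten_img (X : Type) (V W : X -> seq A) s :
  (forall i, W i \in img th (V i)) ->
  flatten [seq W i | i <- s] \in img th (flatten [seq V i | i <- s]).
Proof. by move=> HW; elim: s => [|i s IH] //=; exact: mem_img_cat. Qed.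

(** One marker [w] must serve all [k] and [n], because the families of all the groups share it;
    unbounded lengths allow them to be made distinct. *)
Lemma switch_family_exists : rs_nondegenerate th -> exists2 w, w != [::] &
  forall k n, exists N s, n <= N /\ switch_family w k N s.
Proof.
move=> nd; have [a0 _] := nd.
have [m [V [B [w0 [HV HB neB [Lw0 Sw0] Nw0]]]]] := twin_blocks nd.
have L0 : 0 < L := ltnW L2.
pose b := L ^ m.+1; have b0 : 0 < b by rewrite expn_gt0 L0.
have SB e c : size (B e c) = b.
  by rewrite (size_img (HB e c)) (size_imgp (HV c)) muln1 -expnS.
have [W [LW SW]] := stable_exists Lw0.
have [t Lw] := legal_join LW Lw0.
(* The part [W] makes [w] stable, and [w0] keeps it out of products of blocks. *)
pose w := W ++ t ++ w0; rewrite -/w in Lw.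
have Stw : stable w by exact: (stable_cat (x := [::]) (y := t ++ w0)).
have w0w : infix w0 w by rewrite /w catA suffix_infix.
have [v [u [Lv /imgpSP [z Hz Hu] /infixP [x [y Eu]]]]] := legal_desubstitute m.+1 Lw.
exists w.
  by apply: contraTneq w0w => ->; rewrite infixs0 -size_eq0 Sw0 -lt0n.
(* At least [k] blocks are needed to mark an index, and at least [n] to reach the required
   length. *)
move=> k n; pose K := k + n.
have [c [Lc Sc]] := legal_size a0 (size w + (K + size w)).
(* The blocks over [cm] carry the choice. Those over [cl] and [cr] are buffers at least as long as
   [w], so an occurrence of [w] meeting the middle stays within them. *)
pose cl := take (size w) c; pose cm := take K (drop (size w) c).
pose cr := drop K (drop (size w) c).
have Ec : c = cl ++ cm ++ cr by rewrite !cat_take_drop.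
have Scl : size cl = size w by rewrite size_takel // Sc leq_addr.
have Scm : size cm = K by rewrite size_takel // size_drop Sc addKn leq_addr.
have Scr : size cr = size w by rewrite !size_drop Sc !addKn.
have [t1 L1] := legal_join Lv Lc.
have [t2 {}L2'] := legal_join L1 Lv.
have [T1 HT1] := imgp_inhabited m t1; have [T1' HT1'] := img_inhabited T1.
have [T2 HT2] := imgp_inhabited m t2; have [T2' HT2'] := img_inhabited T2.
pose VV (s : seq A) := flatten [seq V i | i <- s].
pose BB (s : seq A) := flatten [seq B false i | i <- s].
(* For [j < K], the index is encoded by using the [true] variant in block [j] alone. *)
pose M j := flatten [seq B (i == j) (nth a0 cm i) | i <- iota 0 K].
have HVV s : VV s \in imgp th m s.
  by have := @flatten_imgp A m V id s HV; rewrite map_id.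
have HBB s : BB s \in img th (VV s) by apply: flatten_img; exact: HB.
have HM j : M j \in img th (VV cm).
  rewrite /VV -{1}(mkseq_nth a0 cm) Scm /mkseq -map_comp.
  by apply: flatten_img => i /=; exact: HB.
have SM j : size (M j) = K * b.
  rewrite size_flatten /shape -map_comp (eq_map (g := fun=> b)); last by move=> i /=; rewrite SB.
  by rewrite -[K in RHS](size_iota 0); elim: (iota 0 K) => //= ? s ->.
have leq_BB s : size s <= size (BB s).
  rewrite size_flatten /shape -map_comp (eq_map (g := fun=> b)); last by move=> i /=; rewrite SB.
  by elim: s => //= ? s IH; rewrite -add1n leq_add.
have NM j : ~~ infix w (BB cl ++ M j ++ BB cr).
  apply/negP => /(infix_trans w0w); rewrite -!flatten_cat.
  have blk p : p \in [seq B false i | i <- cl] ++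
      [seq B (i == j) (nth a0 cm i) | i <- iota 0 K] ++ [seq B false i | i <- cr] ->
      exists e a, p = B e a.
    by rewrite !mem_cat => /or3P [] /mapP [i _ ->]; do 2!eexists.
  case/(infix_flatten b0 Sw0) => [p /blk [e [a ->]] //|p [p' [/blk [e [a ->]] /blk [e' [a' ->]]]]].
  exact/negP.
(* These cuts do not involve [j], so all words of the family share [l'] and [r']. *)
have [l0 [l' [El Hl]]] := last_occurrence w ((y ++ T1') ++ BB cl).
have [r' [r0 [Er Hr]]] := first_occurrence w (BB cr ++ (T2' ++ x)); rewrite -catA in Er.
have Y1 : (x ++ l0) ++ w ++ l' \in img th (z ++ T1 ++ VV cl).
  rewrite -catA -El (_ : x ++ _ = u ++ T1' ++ BB cl); last by rewrite Eu -!catA.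
  by do 2!apply: mem_img_cat => //.
have Y2 : r' ++ w ++ r0 ++ y \in img th (VV cr ++ T2 ++ z).
  have -> : r' ++ w ++ r0 ++ y = (r' ++ w ++ r0) ++ y by rewrite -!catA.
  rewrite -Er (_ : _ ++ y = BB cr ++ T2' ++ u); last by rewrite Eu -!catA.
  by do 2!apply: mem_img_cat => //.
have LY : rs_legal th ((z ++ T1 ++ VV cl) ++ VV cm ++ VV cr ++ T2 ++ z).
  apply: (@legal_imgp m _ _ L2').
  rewrite Ec -!catA; do 6!apply: mem_imgp_cat => //.
have LY1 : rs_legal th (z ++ T1 ++ VV cl).
  by apply: legal_infix LY; exact: prefix_infix.
exists (size l' + K * b + size r'), (fun j => l' ++ M j ++ r'); split.
  by have := leq_pmulr K b0; lia.
split.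
- by move=> j; rewrite !size_cat SM addnA.
- move=> i j ik jk /eqP.
  rewrite eqseq_cat // eqxx eqseq_cat ?SM // eqxx andbT => /eqP E.
  have {}E : [seq B (i0 == i) (nth a0 cm i0) | i0 <- iota 0 K] =
      [seq B (i0 == j) (nth a0 cm i0) | i0 <- iota 0 K].
    apply: eq_from_flatten_shape E _.
    by rewrite /shape -!map_comp; apply: eq_map => i0 /=; rewrite !SB.
  have iK : i < K by rewrite (leq_trans ik) ?leq_addr.
  have := congr1 (nth [::] ^~ i) E.
  rewrite !(nth_map 0) ?size_iota // nth_iota // add0n eqxx.
  by case: eqP => // _ /neB.
- move=> j; apply: (return_word _ _ (NM j)) El Hl _ Hr.
  + by apply: leq_trans (leq_BB cl); rewrite Scl.
  + by apply: leq_trans (leq_BB cr); rewrite Scr.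
  + exact: Er.
- move=> j; apply: legal_infix (legal_img LY (mem_img_cat Y1 (mem_img_cat (HM j) Y2))).
  by apply/infixP; exists (x ++ l0), (r0 ++ y); rewrite -!catA.
- move=> j j' x' y'; rewrite -!(catA l') -!(catA (M _)).
  exact: (stable_swap Stw LY1 Y1 (HM j) (HM j')).
Qed.

End Language.

(** * Points of the subshift *)

Section Windows.
Variables (A : finType) (th : A -> seq (seq A)) (a0 : A).
Implicit Types (x y : int -> A) (p q k : int) (u v : seq A) (n : nat).

Definition window x p n : seq A := [seq x (p + j%:Z)%R | j <- iota 0 n].

Definition reads x p u : Prop := window x p (size u) = u.

Lemma size_window x p n : size (window x p n) = n.
Proof. by rewrite size_map size_iota. Qed.

Lemma nth_window x p n j : j < n -> nth a0 (window x p n) j = x (p + j%:Z)%R.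
Proof. by move=> jn; rewrite (nth_map 0) ?size_iota // nth_iota. Qed.

Lemma window_cat x p m n : window x p (m + n) = window x p m ++ window x (p + m%:Z)%R n.
Proof.
rewrite /window iotaD map_cat add0n -{2}[m]addn0 iotaDl -map_comp; congr (_ ++ _).
by apply: eq_map => j /=; congr (x _); lia.
Qed.

Lemma eq_window x y p n :
  (forall k, (p <= k < p + n%:Z)%R -> x k = y k) -> window x p n = window y p n.
Proof.
move=> E; apply/eq_in_map => j; rewrite mem_iota => Hj.
by apply: E; lia.
Qed.

Lemma readsP x p u :
  (forall j, j < size u -> x (p + j%:Z)%R = nth a0 u j) <-> reads x p u.
Proof.
split=> [H|<- j].
  apply: (@eq_from_nth _ a0); first by rewrite size_window.
  by move=> j; rewrite size_window => Hj; rewrite nth_window // H.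
by rewrite size_window => Hj; rewrite nth_window.
Qed.

Lemma reads_cat x p u v :
  reads x p (u ++ v) <-> reads x p u /\ reads x (p + (size u)%:Z)%R v.
Proof.
rewrite /reads size_cat window_cat; split=> [/eqP|[-> ->] //].
by rewrite eqseq_cat ?size_window // => /andP [/eqP -> /eqP ->].
Qed.

Lemma reads_inj x p u v : reads x p u -> reads x p v -> size u = size v -> u = v.
Proof. by rewrite /reads => + + E; rewrite E => -> ->. Qed.

Lemma eq_reads x y p u : (forall k, (p <= k < p + (size u)%:Z)%R -> x k = y k) ->
  reads x p u -> reads y p u.
Proof. by move=> /eq_window E; rewrite /reads E. Qed.

Lemma reads_infix x p u d v : reads x p u -> reads x (p + d%:Z)%R v ->
  d + size v <= size u -> u = take d u ++ v ++ drop (d + size v) u.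
Proof.
move=> Hu Hv le; rewrite -{1}(cat_take_drop d u) addnC -drop_drop; congr (_ ++ _).
rewrite -{1}(cat_take_drop (size v) (drop d u)); congr (_ ++ _).
move: Hu; rewrite -{1}(cat_take_drop d u) => /reads_cat [_].
rewrite -{1}(cat_take_drop (size v) (drop d u)) size_takel; last by lia.
move=> /reads_cat [H _]; apply: (reads_inj H Hv).
by rewrite size_takel // size_drop; lia.
Qed.

Lemma window_infix x p n q m : (p <= q)%R -> (q + m%:Z <= p + n%:Z)%R ->
  infix (window x q m) (window x p n).
Proof.
move=> pq qp.
have -> : n = `|(q - p)%R|%N + (m + `|(p + n%:Z - (q + m%:Z))%R|%N) by lia.
rewrite !window_cat (_ : (p + _)%R = q); last by lia.
exact: infix_infix.
Qed.

Lemma eq_in_X x y : (forall k, x k = y k) -> in_X th x -> in_X th y.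
Proof.
by move=> E Hx p n; rewrite -/(window y p n) -(@eq_window x) // => *; exact: Hx.
Qed.

(** Adding a letter on each side again and again gives nested legal words [U n], whose limit is the
    point. *)
Lemma point_exists u : (forall v, rs_legal th v -> exists a b, rs_legal th (a :: rcons v b)) ->
  u != [::] -> rs_legal th u -> exists2 x, in_X th x & reads x 0%R u.
Proof.
move=> ext u0 Lu.
have /choice [F HF] : forall v : {v | rs_legal th v}, exists v' : {v | rs_legal th v},
    exists a b, sval v' = a :: rcons (sval v) b.
  by move=> [v Lv]; have [a [b L']] := ext v Lv; exists (exist _ _ L'), a, b.
pose U n := sval (iter n F (exist _ u Lu)).
have LU n : rs_legal th (U n) by exact: svalP.
have US n : exists a b, U n.+1 = a :: rcons (U n) b by exact: HF.
have SU n : size (U n) = size u + n.*2.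
  elim: n => [|n IH]; first by rewrite addn0.
  by have [a [b ->]] := US n; rewrite /= size_rcons IH doubleS !addnS.
have nthU n d j : j < size (U n) -> nth a0 (U (n + d)) (j + d) = nth a0 (U n) j.
  move=> Hj; elim: d => [|d IH]; first by rewrite !addn0.
  have [a [b E]] := US (n + d); rewrite !addnS E /= nth_rcons SU ifT //.
  by move: Hj; rewrite SU -!addnn; lia.
have u1 : 0 < size u by rewrite lt0n size_eq0.
(* In [U M] the origin stands at offset [M], as each stage adds one letter on the left; stage [|k|]
   already contains position [k]. *)
pose x k := nth a0 (U `|k|%N) `|(k + `|k|%N%:Z)%R|%N.
have xE k M : (`|k| <= M)%N -> x k = nth a0 (U M) `|(k + M%:Z)%R|%N.
  move=> kM; rewrite /x -(nthU _ (M - `|k|%N)); last by rewrite SU -addnn; lia.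
  by congr (nth _ (U _) _); lia.
exists x; last first.
  by apply/readsP => j Hj; rewrite (xE _ j) -?[RHS](nthU 0 j) ?SU ?addn0 //; congr nth; lia.
move=> p n; rewrite -/(window x p n); pose M := (`|p| + n)%N.
apply: legal_infix (LU M).
have -> : window x p n = take n (drop `|(p + M%:Z)%R|%N (U M)).
  apply: (@eq_from_nth _ a0).
    by rewrite size_window size_takel // size_drop SU -addnn /M; lia.
  move=> j; rewrite size_window => Hj; rewrite nth_window // nth_take // nth_drop.
  by rewrite (xE _ M) /M; [congr nth; lia | lia].
by rewrite -{2}(cat_take_drop `|(p + M%:Z)%R|%N (U M)); apply: infix_catl; exact: infix_take.
Qed.

End Windows.

(** * The group action *)

Section Switch.
Variables (A : finType) (th : A -> seq (seq A)) (a0 : A) (w : seq A).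
Variables (I : countType) (G : I -> finGroupType) (n : I -> nat).
Variable s : forall i, G i -> seq A.
Hypothesis n_inj : injective n.
Hypothesis n_gt0 : forall i, 0 < n i.
Hypothesis size_s : forall i (h : G i), size (s h) = n i.
Hypothesis s_inj : forall i, injective (@s i).
Hypothesis ends : forall i (h : G i) u v,
  w ++ s h ++ w = u ++ w ++ v -> u = [::] \/ v = [::].
Hypothesis swap : forall i (h h' : G i) u v,
  rs_legal th (u ++ w ++ s h ++ w ++ v) -> rs_legal th (u ++ w ++ s h' ++ w ++ v).

Notation site := {i : I & G i}.
Implicit Types (x y : int -> A) (p q k : int) (t : site) (g h : forall i, G i).

Definition len t : nat := n (tag t).
Definition word t : seq A := s (tagged t).
Notation W := (size w).

Lemma size_word t : size (word t) = len t.
Proof. exact: size_s. Qed.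

Definition occ x p t : Prop := reads x p (w ++ word t ++ w).

Definition covers x k (pt : int * site) : Prop :=
  occ x pt.1 pt.2 /\ (pt.1 + W%:Z <= k < pt.1 + W%:Z + (len pt.2)%:Z)%R.

Definition act g t : site := Tagged G (g (tag t) * tagged t)%g.

(* [phi g] replaces the middle word [s h], [h : G i], of every occurrence of
   [w ++ s h ++ w] by [s (g i * h)]. *)
Definition phi g x : int -> A := fun k =>
  match excluded_middle_informative (exists pt, covers x k pt) with
  | left H => let pt := proj1_sig (constructive_indefinite_description _ H) in
      nth a0 (word (act g pt.2)) `|(k - pt.1 - W%:Z)%R|%N
  | right _ => x k
  end.

Lemma occE x p t : occ x p t <->
  [/\ reads x p w, reads x (p + W%:Z)%R (word t) &
      reads x (p + W%:Z + (len t)%:Z)%R w].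
Proof.
rewrite /occ !reads_cat size_word.
by split=> [[? [? ?]]|[? ? ?]].
Qed.

Lemma reads_in_occ x p q t : occ x p t -> reads x q w ->
  (p <= q <= p + W%:Z + (len t)%:Z)%R -> q = p \/ q = (p + W%:Z + (len t)%:Z)%R.
Proof.
move=> Ho Hq Hpq; pose d := `|(q - p)%R|%N.
have Eq : q = (p + d%:Z)%R by rewrite /d; lia.
rewrite Eq in Hq; have le : d + W <= size (w ++ word t ++ w).
  by rewrite !size_cat size_word; lia.
have /ends [] := reads_infix Ho Hq le => /(congr1 size) /=.
  by rewrite size_takel; [left | ]; lia.
by rewrite size_drop !size_cat size_word; right; lia.
Qed.

(** The next [w] after position [p] fixes the length, whence the group by [n_inj] and the element by
    [s_inj]. *)
Lemma occ_inj x p t t' : occ x p t -> occ x p t' -> t = t'.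
Proof.
move=> Ho Ho'; have Pt := n_gt0 (tag t); have Pt' := n_gt0 (tag t').
have En : len t = len t'.
  have [/occE [_ _ R] /occE [_ _ R']] := (Ho, Ho').
  have [le|lt] := leqP (len t) (len t').
    by case: (reads_in_occ Ho' R); rewrite /len in le *; lia.
  by case: (reads_in_occ Ho R'); rewrite /len in lt *; lia.
move/n_inj: (En) => Et; case: t t' Et Ho Ho' {Pt Pt' En} => [i h] [i' h'] /= E; subst i'.
move=> /occE [_ R _] /occE [_ R' _].
have /s_inj -> // : s h = s h' by apply: reads_inj R R' _; rewrite !size_word.
Qed.

(** With different starts, the later initial [w] would lie strictly between the two end copies of
    the earlier occurrence. *)
Lemma covers_inj x k pt pt' : covers x k pt -> covers x k pt' -> pt = pt'.
Proof.
case: pt pt' => [p t] [p' t'] [/= Ho Hk] [/= Ho' Hk'].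
have Ep : p = p'.
  have [/occE [R _ _] /occE [R' _ _]] := (Ho, Ho').
  have [le|lt] : (p <= p')%R \/ (p' < p)%R by lia.
    by case: (reads_in_occ Ho R'); lia.
  by case: (reads_in_occ Ho' R); lia.
by rewrite -Ep in Ho' *; rewrite (occ_inj Ho Ho').
Qed.

Lemma phi_covered g x k pt : covers x k pt ->
  phi g x k = nth a0 (word (act g pt.2)) `|(k - pt.1 - W%:Z)%R|%N.
Proof.
move=> Hc; rewrite /phi; case: excluded_middle_informative => [H|[]]; last by exists pt.
by case: constructive_indefinite_description => pt' /= /(covers_inj Hc) <-.
Qed.

Lemma phi_uncovered g x k : (forall pt, ~ covers x k pt) -> phi g x k = x k.
Proof. by move=> H; rewrite /phi; case: excluded_middle_informative => // E; by exfalso; case: E => pt /H. Qed.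

Lemma phi_fixed g x k pt : covers x k pt -> g (tag pt.2) = 1%g -> phi g x k = x k.
Proof.
move=> Hc g1; rewrite (phi_covered g Hc) /act g1 mul1g.
case: pt Hc {g1} => p [i h] [/= Ho Hk].
have [_ R _] := (occE _ _ _).1 Ho.
have := (readsP a0 _ _ _).2 R `|(k - p - W%:Z)%R|%N; rewrite size_word /word /= => <-; last by lia.
by congr x; lia.
Qed.

Lemma uncovered_of_reads x q k : reads x q w -> (q <= k < q + W%:Z)%R ->
  forall pt, ~ covers x k pt.
Proof.
move=> R Hk [p t] [/= Ho Hc].
by case: (reads_in_occ Ho R); lia.
Qed.

Lemma reads_phi g x q : reads x q w -> reads (phi g x) q w.
Proof.
move=> R; apply: eq_reads (R) => k Hk; rewrite phi_uncovered //.
exact: uncovered_of_reads Hk.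
Qed.

Lemma occ_phi g x p t : occ x p t -> occ (phi g x) p (act g t).
Proof.
move=> Ho; have [R1 R2 R3] := (occE _ _ _).1 Ho.
apply/occE; split; [exact: reads_phi | | exact: reads_phi].
apply/(readsP a0) => j; rewrite size_word => Hj.
rewrite (@phi_covered _ _ _ (p, t)); last by split=> //=; rewrite /len /= in Hj *; lia.
by congr nth; rewrite /=; lia.
Qed.

(** A new [w] overlapping a changed stretch would start strictly between the end markers of an
    occurrence in [phi g x], which [ends] excludes. *)
Lemma reads_phi_inv g x q : reads (phi g x) q w -> reads x q w.
Proof.
move=> R.
case: (classic (exists k pt, (q <= k < q + W%:Z)%R /\ covers x k pt)) => [|N].
  move=> [k [[p t] [Hk [/= Ho Hc]]]].
  by case: (reads_in_occ (occ_phi g Ho) R); rewrite /len /= in Hc *; lia.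
apply: eq_reads (R) => k Hk; rewrite phi_uncovered // => pt Hc.
by apply: N; exists k, pt.
Qed.

Lemma occ_phi_inv g x p t : occ (phi g x) p t ->
  exists t', tag t' = tag t /\ occ x p t'.
Proof.
move=> Ho; have [R1 R2 R3] := (occE _ _ _).1 Ho.
have S1 := reads_phi_inv R1; have S3 := reads_phi_inv R3.
case: (classic (exists k pt, (p + W%:Z <= k < p + W%:Z + (len t)%:Z)%R /\ covers x k pt)).
  move=> [k [[p' t'] [Hk [/= Ho' Hc]]]].
  have Ep : p' = p.
    have [lt|[gt|//]] : (p' < p)%R \/ (p < p')%R \/ p' = p by lia.
      by case: (reads_in_occ Ho' S1); lia.
    have [R' _ _] := (occE _ _ _).1 (occ_phi g Ho').
    by case: (reads_in_occ Ho R'); lia.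
  rewrite {}Ep in Ho' Hc; exists t'; split=> //.
  by rewrite -(occ_inj (occ_phi g Ho') Ho).
move=> N; exists t; split=> //; apply/occE; split=> //.
apply: eq_reads (R2) => k; rewrite size_word => Hk.
by rewrite phi_uncovered // => pt Hc; apply: N; exists k, pt.
Qed.

(** Acting by [h] creates and destroys no occurrence, so [g] then multiplies on the left at the same
    places. *)
Lemma phi_mul g h x k : phi (fun i => (g i * h i)%g) x k = phi g (phi h x) k.
Proof.
case: (classic (exists pt, covers x k pt)) => [[[p t] Hc]|N].
  rewrite (phi_covered _ Hc); case: Hc => /= Ho Hk.
  rewrite (@phi_covered _ _ _ (p, act h t)) /=; last by split=> //=; exact: occ_phi.
  by rewrite /act /= mulgA.
rewrite phi_uncovered; last by move=> pt Hc; apply: N; exists pt.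
rewrite phi_uncovered; last first.
  move=> [p t] [/= /occ_phi_inv [t' [Et Ho]] Hk].
  by apply: N; exists (p, t'); split=> //=; rewrite /len Et.
by rewrite phi_uncovered // => pt Hc; apply: N; exists pt.
Qed.

Lemma phi1 g x k : (forall i, g i = 1%g) -> phi g x k = x k.
Proof.
move=> g1; case: (classic (exists pt, covers x k pt)) => [[pt Hc]|N].
  exact: phi_fixed Hc _.
by apply: phi_uncovered => pt Hc; apply: N; exists pt.
Qed.

Lemma occ_shift x p t : occ (shift x) p t <-> occ x (p + 1)%R t.
Proof.
have E m : window (shift x) p m = window x (p + 1)%R m.
  by apply: eq_map => j; rewrite /shift; congr x; lia.
by rewrite /occ /reads E.
Qed.

Lemma phi_shift g x k : phi g (shift x) k = shift (phi g x) k.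
Proof.
rewrite /shift; case: (classic (exists pt, covers x (k + 1)%R pt)) => [[[p t] Hc]|N].
  rewrite (phi_covered _ Hc); case: Hc => /= Ho Hk.
  rewrite (@phi_covered _ _ _ ((p - 1)%R, t)) /=; first by congr nth; lia.
  by split=> /=; [apply/occ_shift; rewrite GRing.subrK | lia].
rewrite [RHS]phi_uncovered; last by move=> pt Hc; apply: N; exists pt.
rewrite phi_uncovered // => -[p t] [/= /occ_shift Ho Hk].
by apply: N; exists ((p + 1)%R, t); split=> //=; lia.
Qed.

(** Every window extends to one containing the whole occurrence, where the two points differ by a
    single [swap]. *)
Lemma in_X_switch x y p t t' : in_X th x -> occ x p t -> occ y p t' -> tag t = tag t' ->
  (forall k, ~~ (p + W%:Z <= k < p + W%:Z + (len t)%:Z)%R -> x k = y k) -> in_X th y.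
Proof.
move=> Hx Ho Ho' Et E q m.
pose a := `|(p - q)%R|%N; pose r := W + (len t + W).
pose b := (`|(p - q)%R| + m)%N.
apply: (@legal_infix _ _ (window y q m) (window y (p - a%:Z)%R (a + (r + b)))).
  by apply: window_infix; rewrite /a /b; lia.
have := Hx (p - a%:Z)%R (a + (r + b)); rewrite -/(window x _ _).
rewrite !(window_cat _ _ a) !(window_cat _ _ r) !GRing.subrK.
have -> : window x p r = w ++ word t ++ w by rewrite -[RHS]Ho !size_cat size_word.
have -> : window y p r = w ++ word t' ++ w.
  by rewrite -[RHS]Ho' !size_cat size_word /len -Et.
rewrite (@eq_window _ x y _ a); last by move=> k Hk; apply: E; lia.
rewrite (@eq_window _ x y _ b); last by move=> k Hk; apply: E; rewrite /r in Hk; lia.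
move: (window y _ a) (window y _ b) => u v.
case: t t' Et {Ho Ho' E r b} => [i h] [i' h'] /= Ei; subst i'.
by rewrite -!catA; exact: swap.
Qed.

(** * Automorphisms from finitely supported elements *)

Definition bounded_support g B : Prop := forall i, B < n i -> g i = 1%g.

Lemma finsupp_bounded g : finsupp g -> exists B, bounded_support g B.
Proof.
move=> [r Hr]; exists (\max_(i <- r) n i) => i Hi; apply: Hr.
by apply: contraTN Hi => ir; rewrite -leqNgt; exact: leq_bigmax_seq.
Qed.

Lemma in_X_phi g B x : bounded_support g B -> in_X th x -> in_X th (phi g x).
Proof.
move=> gB Hx.
(* [H p m] performs only the switches at occurrences starting in the [m] positions from [p] on, so
   raising [m] by one makes at most one switch. *)
pose partial p m k (pt : int * site) := covers x k pt /\ (p <= pt.1 < p + m%:Z)%R.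
pose H p m k := if excluded_middle_informative (exists pt, partial p m k pt)
                then phi g x k else x k.
have H1 p m k pt : partial p m k pt -> H p m k = phi g x k.
  by move=> Hp; rewrite /H; case: excluded_middle_informative => // -[]; exists pt.
have H0 p m k : (forall pt, ~ partial p m k pt) -> H p m k = x k.
  by move=> Hp; rewrite /H; case: excluded_middle_informative => // E; exfalso; case: E => pt /Hp.
have XH p m : in_X th (H p m).
  elim: m => [|m IH].
    by apply: eq_in_X Hx => k; rewrite H0 // => pt [_]; lia.
  have HS k : (forall t, ~ covers x k ((p + m%:Z)%R, t)) -> H p m k = H p m.+1 k.
    move=> N; case: (classic (exists pt, partial p m.+1 k pt)) => [[[q t] [Hc /= Hq]]|N'].
      rewrite (H1 p m.+1 k (q, t)) // (H1 p m k (q, t)) //; split=> //=.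
      suff : q <> (p + m%:Z)%R by lia.
      by move=> Eq; apply: (N t); rewrite -Eq.
    rewrite !H0 // => pt Hp; apply: N'; exists pt => //.
    by case: Hp => Hc Hq; split=> //; lia.
  case: (classic (exists t, occ x (p + m%:Z)%R t)) => [[t Ho]|N]; last first.
    by apply: eq_in_X IH => k; apply: HS => t [Ho _]; apply: N; exists t.
  have [R1 R2 R3] := (occE _ _ _).1 Ho.
  have flank q d : reads x q w -> reads (H p d) q w.
    move=> R; apply: eq_reads (R) => k Hk; rewrite H0 // => pt [Hc _].
    exact: (uncovered_of_reads R Hk) Hc.
  have cov k : (p + m%:Z + W%:Z <= k < p + m%:Z + W%:Z + (len t)%:Z)%R ->
      covers x k ((p + m%:Z)%R, t) by [].
  apply: (in_X_switch (p := (p + m%:Z)%R) (t := t) (t' := act g t) IH) => //.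
  (* The occurrence at [p + m] is not yet switched in [H p m], and no other occurrence covers its
     middle. *)
  - apply/occE; split; [exact: flank | | exact: flank].
    apply: eq_reads (R2) => k; rewrite size_word => Hk.
    by rewrite H0 // => pt [/(covers_inj (cov k Hk)) <- /=]; lia.
  - have [_ R _] := (occE _ _ _).1 (occ_phi g Ho).
    apply/occE; split; [exact: flank | | exact: flank].
    apply: eq_reads (R) => k; rewrite size_word => Hk.
    by rewrite (H1 _ _ _ ((p + m%:Z)%R, t)) //; split; [exact: cov | rewrite /=; lia].
  - move=> k Nk; apply: HS => t' [/= Ho' Hk].
    by rewrite -(occ_inj Ho Ho') (negPf Nk) in Hk.
move=> q m; rewrite -/(window (phi g x) q m).
(* Occurrences with middle length at most [B] that reach the window start at or after this [p]; on
   longer ones [g] is trivial. *)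
pose p := (q - W%:Z - B%:Z)%R.
rewrite -(@eq_window _ (H p (W + B + m)%N)); first exact: XH.
move=> k Hk; case: (classic (exists pt, partial p (W + B + m)%N k pt)) => [[pt /H1] //|N].
rewrite H0; last by move=> pt Hp; apply: N; exists pt.
case: (classic (exists pt, covers x k pt)) => [[[r t] Hc]|N'].
  rewrite (phi_fixed Hc) //; apply: gB => /=.
  have [le|//] := leqP (n (tag t)) B; case: N; exists (r, t); split=> //.
  by case: Hc; rewrite /= /len /p; lia.
by rewrite phi_uncovered // => pt Hc; apply: N'; exists pt.
Qed.

Lemma cont_phi g B : bounded_support g B -> cont_X th (phi g).
Proof.
(* This radius contains every occurrence that covers some [|k| <= d] and has middle length at most
   [B]. *)
move=> gB x Hx d; exists (d + W + W + B) => y Hy Exy.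
have tr z z' k p t : agree z z' (d + W + W + B) -> (`|k| <= d)%N -> len t <= B ->
    covers z k (p, t) -> covers z' k (p, t).
  move=> Ez kd tB [/= Ho Hk]; split=> //=.
  by apply: eq_reads (Ho) => l; rewrite !size_cat size_word => Hl; apply: Ez; lia.
have Eyx : agree y x (d + W + W + B) by move=> k Hk; rewrite Exy.
have fixd z k : (forall p t, len t <= B -> ~ covers z k (p, t)) -> phi g z k = z k.
  move=> N; case: (classic (exists pt, covers z k pt)) => [[[p t] Hc]|N'].
    apply: (phi_fixed Hc); apply: gB => /=; rewrite ltnNge; apply/negP => le.
    exact: N Hc.
  by apply: phi_uncovered => pt Hc; apply: N'; exists pt.
move=> k kd.
case: (classic (exists p t, len t <= B /\ covers x k (p, t))) => [[p [t [tB Hc]]]|N].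
  by rewrite (phi_covered g Hc) (phi_covered g (tr _ _ _ _ _ Exy kd tB Hc)).
rewrite !fixd; first by apply: Exy; lia.
  by move=> p t tB /(tr _ _ _ _ _ Eyx kd tB) Hc; apply: N; exists p, t.
by move=> p t tB Hc; apply: N; exists p, t.
Qed.

Lemma phi_aut g : finsupp g -> is_aut th (phi g).
Proof.
move=> /finsupp_bounded [B gB].
have vB : bounded_support (fun i => (g i)^-1)%g B by move=> i /gB ->; rewrite invg1.
split.
- by move=> x; exact: in_X_phi gB.
- exact: cont_phi gB.
- by move=> x _; apply: functional_extensionality => k; exact: phi_shift.
exists (phi (fun i => (g i)^-1)%g); split.
- by move=> x; exact: in_X_phi vB.
- exact: cont_phi vB.
- move=> x _; apply: functional_extensionality => k.
  by rewrite -phi_mul phi1 // => i; rewrite mulVg.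
- move=> x _; apply: functional_extensionality => k.
  by rewrite -phi_mul phi1 // => i; rewrite mulgV.
Qed.

(** On a point with the word of the identity after the marker at the origin, the two images show
    [s (g i)] and [s (h i)]. *)
Lemma phi_inj g h i : (exists2 x, in_X th x & reads x 0%R (w ++ s (1%g : G i) ++ w)) ->
  (forall x, in_X th x -> phi g x = phi h x) -> g i = h i.
Proof.
move=> [x Hx R] E; have Ho : occ x 0%R (Tagged G (1%g : G i)) by [].
have [_ + _] := (occE _ _ _).1 (occ_phi g Ho); rewrite E // => R1.
have [_ R2 _] := (occE _ _ _).1 (occ_phi h Ho).
have := reads_inj R1 R2; rewrite !size_word => /(_ erefl).
by rewrite /word /= !mulg1 => /s_inj.
Qed.

End Switch.

(** * The embedding of the direct sum *)

(** For [L = 1], compatibility would make all images of a letter the same single letter, against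
    non-degeneracy. *)
Lemma constant_length_gt1 (A : finType) (th : A -> seq (seq A)) L :
  rs_wf th -> rs_nondegenerate th -> rs_compatible th ->
  (forall a u, u \in th a -> size u = L) -> 1 < L.
Proof.
move=> wf [a nd] comp thL; have [_ /allP ne] := wf a.
have := undup_uniq (th a); have := mem_undup (th a); case: (undup (th a)) nd => [|u [|v r]] //= _ Hm.
have uth : u \in th a by rewrite -Hm mem_head.
have vth : v \in th a by rewrite -Hm !inE eqxx orbT.
rewrite inE negb_or => /andP [/andP [uv _] _] {Hm}.
have [Lu Lv] := (thL _ _ uth, thL _ _ vth).
case: L thL Lu Lv => [|[|//]] _; first by move/size0nil => E; have := ne _ uth; rewrite E.
case: u uth uv => [|b [|//]] //= uth uv _; case: v vth uv => [|c [|//]] //= vth uv _.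
have := comp _ _ _ uth vth b; rewrite /= eqxx !addn0.
by case: (c =P b) => // E; rewrite E eqxx in uv.
Qed.

Theorem theorem6p10 (A : finType) (th : A -> seq (seq A)) :
  rs_wf th -> rs_nondegenerate th -> rs_constant_length th -> rs_primitive th ->
  rs_compatible th -> rs_disjoint_images th ->
  (exists u, rs_recognisable th u) ->
  forall (I : countType) (G : I -> finGroupType),
    exists phi : (forall i, G i) -> (int -> A) -> (int -> A),
      [/\ (forall g, finsupp g -> is_aut th (phi g)),
          (forall g h, finsupp g -> finsupp h -> forall x, in_X th x ->
              phi (fun i => (g i * h i)%g) x = phi g (phi h x)) &
          (forall g h, finsupp g -> finsupp h ->
              (forall x, in_X th x -> phi g x = phi h x) -> forall i, g i = h i)].
Proof.
move=> wf nd [L thL] prim comp disj _ I G.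
have L2 := constant_length_gt1 wf nd comp thL.
have [a0 _] := nd.
have [w wn fam] := switch_family_exists wf thL disj prim L2 nd.
have /choice [F HF] : forall km : nat * nat, exists Ns : nat * (nat -> seq A),
    km.2 <= Ns.1 /\ switch_family th w km.1 Ns.1 Ns.2.
  by move=> [k m]; have [N [s H]] := fam k m; exists (N, s).
(* Numbers that code no index of [I] get the dummy size [0]. *)
pose K j := if unpickle j is Some i then #|G i| else 0.
(* [T j] is the lower bound imposed on the length [N j]: one more than the previous length, starting
   from [1]. Lengths are thus positive and strictly increasing. *)
pose T := fix T j := if j is j'.+1 then (F (K j', T j')).1.+1 else 1.
pose N j := (F (K j, T j)).1.
have TN j : T j <= N j by have [] := HF (K j, T j).
have N_gt0 j : 0 < N j by apply: leq_trans (TN j); case: j.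
have N_lt j d : N j < N (j + d.+1).
  elim: d => [|d IH]; first by rewrite addn1; exact: (TN j.+1).
  by apply: (ltn_trans IH); rewrite [j + d.+2]addnS; exact: (TN (j + d.+1).+1).
have N_inj : injective N.
  move=> j j' E; have [lt|lt|//] := ltngtP j j'.
    by have := N_lt j (j' - j).-1; rewrite prednK ?subn_gt0 // subnKC ?E ?ltnn // ltnW.
  by have := N_lt j' (j - j').-1; rewrite prednK ?subn_gt0 // subnKC -?E ?ltnn // ltnW.
pose n (i : I) := N (pickle i).
(* Ranks of elements stay below the order of [G i], the range in which the words are distinct. *)
pose s i (h : G i) := (F (K (pickle i), T (pickle i))).2 (enum_rank h).
have famP i : switch_family th w #|G i| (n i) (F (K (pickle i), T (pickle i))).2.
  have EK : K (pickle i) = #|G i| by rewrite /K pickleK.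
  by have [_] := HF (K (pickle i), T (pickle i)); rewrite /n /N /= EK.
have n_inj : injective n by move=> i i' /N_inj /(pcan_inj pickleK).
have n_gt0 i : 0 < n i := N_gt0 _.
have size_s i (h : G i) : size (s i h) = n i by have [H _ _ _ _] := famP i; exact: H.
have s_inj i : injective (s i).
  move=> h h'; have [_ H _ _ _] := famP i.
  by move=> /(H _ _ (ltn_ord _) (ltn_ord _)) /ord_inj /enum_rank_inj.
have ends i (h : G i) u v : w ++ s i h ++ w = u ++ w ++ v -> u = [::] \/ v = [::].
  by have [_ _ H _ _] := famP i; exact: H.
have swap i (h h' : G i) u v :
    rs_legal th (u ++ w ++ s i h ++ w ++ v) -> rs_legal th (u ++ w ++ s i h' ++ w ++ v).
  by have [_ _ _ _ H] := famP i; exact: H.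
exists (phi a0 w n s); split.
- by move=> g; exact: phi_aut.
- by move=> g h _ _ x _; apply: functional_extensionality => k; exact: phi_mul.
move=> g h _ _ E i; apply: (phi_inj n_inj n_gt0 size_s s_inj ends _ E).
apply: (point_exists a0 (legal_extend wf thL prim L2)).
  by case: (w) wn.
by have [_ _ _ H _] := famP i; exact: H.
Qed.
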